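(* Let $A$ and $B$ be two subspaces of $R^n$. Then $$\max\{\dim(A),\dim(B)\}\leq\dim(A+B)\leq\min\{n,\ \dim(A)+\dim(B)-\dim(A\cap B)\},$$ and the following statements are equivalent: (i) $\dim(A+B)=\dim(A)+\dim(B)-\dim(A\cap B)$; (ii) $A+B$ is a subspace of $R^n$; (iii) $A\cap B$ is a subspace of $R^n$.
   Context: $R$ is a finite commutative ring with identity $1\neq 0$. $R^n$ denotes the free module of row vectors of length $n$ over $R$. A set $\{\alpha_1,\dots,\alpha_m\}\subseteq R^n$ is unimodular if the $m\times n$ matrix with rows $\alpha_1,\dots,\alpha_m$ has a right inverse in $R^{n\times m}$. A linear subset of $R^n$ is an $R$-submodule; its dimension $\dim(V)$ is the maximum number of vectors in a unimodular subset of $V$. An $m$-subspace (a subspace of dimension $m$) of $R^n$ is an $R$-submodule having a basis of $m$ vectors which form a unimodular set; the $0$-subspace is $\{0\}$. For subspaces $A,B$, $A\cap B$ is their set-theoretic intersection and $A+B=\{a+b:a\in A,b\in B\}$; these are linear subsets. *)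

(* Defs.v *)
From HB Require Import structures.
From mathcomp Require Import all_boot all_order all_algebra.

Set Implicit Arguments.
Unset Strict Implicit.
Unset Printing Implicit Defensive.

Import GRing.Theory.
Local Open Scope ring_scope.

(* The ordering of the rows is the one given by [enum S]; reordering the rows
   does not affect the existence of a right inverse. *)
Definition rows_mx (R : finComNzRingType) (n : nat) (S : {set 'rV[R]_n}) :
    'M[R]_(#|S|, n) :=
  \matrix_(i < #|S|) (enum_val i : 'rV[R]_n).

Definition unimodular (R : finComNzRingType) (n : nat) (S : {set 'rV[R]_n}) :
    bool :=
  [exists N : 'M[R]_(n, #|S|), rows_mx S *m N == 1%:M].

Definition linear_subset (R : finComNzRingType) (n : nat)
    (V : {set 'rV[R]_n}) : Prop :=
  submod_closed V.

(* The empty set is unimodular, so this is the maximum of a nonempty family. *)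
Definition lsdim (R : finComNzRingType) (n : nat) (V : {set 'rV[R]_n}) : nat :=
  (\max_(S : {set 'rV[R]_n} | (S \subset V) && unimodular S) #|S|)%N.

Definition lin_indep (R : finComNzRingType) (n : nat) (S : {set 'rV[R]_n}) :
    Prop :=
  forall c : 'rV[R]_n -> R,
    \sum_(s in S) c s *: s = 0 -> forall s, s \in S -> c s = 0.

Definition generates (R : finComNzRingType) (n : nat)
    (S V : {set 'rV[R]_n}) : Prop :=
  forall v : 'rV[R]_n,
    v \in V <-> exists c : 'rV[R]_n -> R, v = \sum_(s in S) c s *: s.

Definition is_basis (R : finComNzRingType) (n : nat)
    (S V : {set 'rV[R]_n}) : Prop :=
  lin_indep S /\ generates S V.

Definition m_subspace (R : finComNzRingType) (n m : nat)
    (V : {set 'rV[R]_n}) : Prop :=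
  linear_subset V /\
  exists S : {set 'rV[R]_n}, [/\ #|S| = m, is_basis S V & unimodular S].

Definition subspace (R : finComNzRingType) (n : nat)
    (V : {set 'rV[R]_n}) : Prop :=
  exists m : nat, m_subspace m V.

Definition sum_set (R : finComNzRingType) (n : nat)
    (A B : {set 'rV[R]_n}) : {set 'rV[R]_n} :=
  [set a + b | a in A, b in B].

(* In particular lsdim (A :&: B) <= lsdim A, so the truncated subtraction in
   lsdim A + lsdim B - lsdim (A :&: B) is an actual subtraction. *)
Lemma lsdimS (R : finComNzRingType) (n : nat) (A B : {set 'rV[R]_n}) :
  A \subset B -> (lsdim A <= lsdim B)%N.
Proof.
move=> sAB; apply/bigmax_leqP => S /andP[sSA uS].
apply: (@leq_bigmax_cond _ _ (fun S : {set 'rV[R]_n} => #|S|)).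
by rewrite (subset_trans sSA sAB).
Qed.

Lemma subspace0 (R : finComNzRingType) (n : nat) :
  m_subspace 0 [set (0 : 'rV[R]_n)].
Proof.
split.
  split; first by rewrite inE.
  by move=> a u v; rewrite !inE => /eqP-> /eqP->; rewrite scaler0 addr0.
exists set0; split; first by rewrite cards0.
  split; first by move=> c _ s; rewrite inE.
  move=> v; rewrite inE; split.
    by move/eqP->; exists (fun=> 0); rewrite big_set0.
  by case=> c ->; rewrite big_set0.
apply/existsP; exists 0; apply/eqP/matrixP => i.
by have := ltn_ord i; rewrite {2}cards0.
Qed.

(* Main.v *)
Require Import Defs.
From HB Require Import structures.
From mathcomp Require Import all_boot all_order all_algebra all_fingroup.

(** Over a finite commutative ring every linearly independent family of row
    vectors has a right inverse and extends to a basis: powers of an element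
    become idempotent, so the ring has stable range one, which allows Gaussian
    elimination without splitting it into local factors.  A unimodular
    [m]-family spans [#|R| ^ m] vectors, so [#|A + B| * #|A :&: B| = #|A| * #|B|]
    yields the upper bound on [dim (A + B)], and in case of equality forces
    maximal unimodular families of [A + B] and [A :&: B] to span.  Conversely,
    if [A + B] is a subspace, the relations between the concatenated bases of
    [A] and [B] form a free module, giving a large independent family in
    [A :&: B]; if [A :&: B] is a subspace, completing a basis of it to bases of
    [A] and of [B] gives an independent family in [A + B]. *)

Set Implicit Arguments.
Unset Strict Implicit.
Unset Printing Implicit Defensive.

Import GRing.Theory.
Local Open Scope ring_scope.

(** * Idempotent powers and stable range one *)

Lemma expr_idempotent (R : finComNzRingType) (a : R) :
  exists2 N, (0 < N)%N & a ^+ N * a ^+ N = a ^+ N.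
Proof.
have [i [p p_gt0 ai]] : exists i, exists2 p, (0 < p)%N & a ^+ (i + p) = a ^+ i.
  pose f (k : 'I_#|R|.+1) := a ^+ k.
  have /injectivePn [i [j neq_ij eq_ij]] : ~~ injectiveb f.
    by apply/injectiveP => /leq_card; rewrite card_ord ltnn.
  wlog lt_ij : i j neq_ij eq_ij / (i < j)%N.
    move=> wl; case: (ltngtP i j) => [||/val_inj eij]; first exact: wl.
      by apply: wl => //; rewrite eq_sym.
    by rewrite eij eqxx in neq_ij.
  exists i, (j - i)%N; first by rewrite subn_gt0.
  by rewrite subnKC ?(ltnW lt_ij) // -/(f j) -eq_ij.
have akj k j : (i <= k)%N -> a ^+ (k + j * p) = a ^+ k.
  move=> le_ik; elim: j => [|j IHj]; first by rewrite addn0.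
  rewrite mulSn addnCA exprD IHj -exprD addnC -{1}(subnKC le_ik) addnAC.
  by rewrite exprD ai -exprD subnKC.
(* This exponent is a multiple of the period [p] and is at least [i], so doubling it does not change
   the power; the successor keeps it positive when [i] is 0. *)
exists (i.+1 * p)%N; first by rewrite muln_gt0.
by rewrite -exprD akj // (leq_trans (leqnSn i)) // leq_pmulr.
Qed.

(** Multiplication by [c] is injective on a finite set, hence bijective, so it reaches 1. *)
Lemma regular_inv (R : finComNzRingType) (c : R) :
  (forall y, y * c = 0 -> y = 0) -> exists d, d * c = 1.
Proof.
move=> reg_c; have inj_c : injective (fun y => y * c).
  by move=> x y /eqP; rewrite -subr_eq0 -mulrBl => /eqP/reg_c/eqP;
     rewrite subr_eq0 => /eqP.
by have [g _ gK] := injF_bij inj_c; exists (g 1); rewrite gK.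
Qed.

(* Stable range one.  On the part of the ring where the idempotent a ^+ N is
   1, a is invertible; on the complementary part a is nilpotent, hence b is
   invertible there and so is a + b. *)
Lemma comaximal_unit (R : finComNzRingType) (a b x : R) :
  a * x + b = 1 -> exists t d, d * (a + t * b) = 1.
Proof.
move=> ab1; have [N N_gt0 idemN] := expr_idempotent a.
exists (1 - a ^+ N); apply: regular_inv => y yc0.
have ye0 : y * a ^+ N = 0.
  have : y * (a + (1 - a ^+ N) * b) * a ^+ N = 0 by rewrite yc0 mul0r.
  rewrite -mulrA mulrDl mulrAC mulrBl mul1r idemN subrr mul0r addr0 => y0.
  by rewrite -idemN -{1}(prednK N_gt0) exprSr -mulrA mulrCA y0 mulr0.
move: yc0; rewrite mulrDr mulrA mulrBr mulr1 ye0 subr0 -mulrDr => yab0.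
have b_def : b = 1 - a * x by rewrite -ab1 addrAC subrr add0r.
(* Substituting [b = 1 - a * x] into [y * (a + b) = 0] gives this; iterating it [N] times produces
   the factor [a ^+ N], which [y] kills. *)
have y_def : y = y * ((x - 1) * a).
  apply/eqP; rewrite -subr_eq0 -{1}[y]mulr1 -mulrBr -[X in _ == X]yab0 b_def.
  by apply/eqP; congr (y * _); rewrite mulrBl mul1r opprB [x * a]mulrC addrCA.
have yk k : y = y * ((x - 1) * a) ^+ k.
  by elim: k => [|k IHk]; rewrite ?mulr1 // exprS mulrA -y_def.
by rewrite (yk N) exprMn mulrCA ye0 mulr0.
Qed.

(** * Gaussian elimination on linearly independent rows *)

Section InjectiveRows.

Variable R : finComNzRingType.

Definition row_injective m n (M : 'M[R]_(m, n)) :=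
  forall u : 'rV_m, u *m M = 0 -> u = 0.

Lemma rinv_row_injective m n (M : 'M[R]_(m, n)) N :
  M *m N = 1%:M -> row_injective M.
Proof. by move=> MN1 u uM0; rewrite -[u]mulmx1 -MN1 mulmxA uM0 mul0mx. Qed.

Lemma row_injectiveP m n (M : 'M[R]_(m, n)) :
  row_injective M -> injective (fun u : 'rV_m => u *m M).
Proof.
by move=> injM u v /eqP; rewrite -subr_eq0 -mulmxBl => /eqP/injM/eqP;
   rewrite subr_eq0 => /eqP.
Qed.

Lemma leq_card_exp a b : (#|R| ^ a <= #|R| ^ b)%N = (a <= b)%N.
Proof. by rewrite leq_exp2l // card_finNzRing_gt1. Qed.

Lemma row_injective_leq m n (M : 'M[R]_(m, n)) : row_injective M -> (m <= n)%N.
Proof.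
by move/row_injectiveP/leq_card; rewrite !card_mx !mul1n leq_card_exp.
Qed.

(* x is split as x a0^N + x (1 - a0^N): the first summand lies in x (a0), and
   on the second a0 is nilpotent, so a nonzero multiple of it is killed by a0. *)
Lemma ideal_or_annihilated n (a : 'rV[R]_n) (x : R) :
  (exists y : 'cV_n, x *: (a *m y) = x%:M) \/
  (exists2 r, x * r != 0 & (x * r) *: a = 0).
Proof.
elim: n a x => [|n IHn] a x.
  have [->|x_neq0] := eqVneq x 0.
    by left; exists 0; rewrite scale0r raddf0.
  by right; exists 1; rewrite ?mulr1 // [a]thinmx0 scaler0.
rewrite -[n.+1]/(1 + n)%N in a *.
rewrite -[a]hsubmxK [lsubmx a]mx11_scalar; move: (lsubmx a 0 0) (rsubmx a) => {a} a0 a.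
have [N N_gt0 idemN] := expr_idempotent a0.
have [[y xy]|[r xr_neq0 xra0]] := IHn a (x * (1 - a0 ^+ N)).
  (* The head contributes [x * a0 ^+ N] and the tail [x * (1 - a0 ^+ N)]. *)
  left; exists (col_mx (a0 ^+ N.-1)%:M ((1 - a0 ^+ N) *: y)).
  rewrite mul_row_col -scalar_mxM -exprS prednK // -scalemxAr scalerDr scalerA xy.
  by rewrite scale_scalar_mx -raddfD -mulrDr addrC subrK mulr1.
right; have exk : exists k, x * (1 - a0 ^+ N) * r * a0 ^+ k == 0.
  exists N; rewrite mulrAC -[x * _ * _]mulrA mulrBl mul1r idemN subrr.
  by rewrite mulr0 mul0r.
(* The least exponent is positive; its predecessor gives a nonzero multiple of [x] killed by [a0],
   and also by the tail because of the factor [r]. *)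
case: (ex_minnP exk) => [] [|k] /eqP xk0 mink.
  by rewrite expr0 mulr1 in xk0; rewrite xk0 eqxx in xr_neq0.
exists ((1 - a0 ^+ N) * r * a0 ^+ k); rewrite !mulrA.
  by apply/negP => /mink; rewrite ltnn.
rewrite scale_row_mx scale_scalar_mx -mulrA -exprSr xk0 raddf0.
by rewrite mulrC -scalerA xra0 scaler0 row_mx0.
Qed.

Lemma row_injective_rV n (a : 'rV[R]_n) :
  row_injective a -> exists y : 'cV_n, a *m y = 1%:M.
Proof.
move=> inj_a; case: (ideal_or_annihilated a 1) => [[y]|[r]].
  by rewrite scale1r; exists y.
rewrite mul1r -mul_scalar_mx => r_neq0 /inj_a/matrixP/(_ 0 0).
by rewrite !mxE eqxx mulr1n => r0; rewrite r0 eqxx in r_neq0.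
Qed.

Lemma row_injective_rV_normal n (a : 'rV[R]_(1 + n)) :
  row_injective a ->
  exists P P' : 'M[R]_(1 + n), P *m P' = 1%:M /\ a *m P = row_mx 1%:M 0.
Proof.
case/row_injective_rV=> y; rewrite -[a]hsubmxK -[y]vsubmxK.
rewrite [lsubmx a]mx11_scalar [usubmx y]mx11_scalar.
move: (lsubmx a 0 0) (rsubmx a) (usubmx y 0 0) (dsubmx y) => {a y} a0 a y0 y.
rewrite mul_row_col -scalar_mxM [a *m y]mx11_scalar; set b := (a *m y) 0 0.
rewrite -raddfD => /matrixP/(_ 0 0); rewrite !mxE eqxx !mulr1n => ab1.
have [t [d dc1]] := comaximal_unit ab1.
set c := a0 + t * b in dc1.
have cd1 : c * d = 1 by rewrite mulrC.
(* The first factor turns the leading entry into the unit [c] by stable range one and scales it to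
   1; the second clears the tail. *)
exists (block_mx d%:M 0 (t *: y *m d%:M) 1%:M *m block_mx 1%:M (- a) 0 1%:M).
exists (block_mx 1%:M a 0 1%:M *m block_mx c%:M 0 (- t *: y) 1%:M).
split.
  rewrite -mulmxA [X in _ *m X]mulmxA mulmx_block !(mul1mx, mulmx1, mul0mx, mulmx0).
  rewrite !(addr0, add0r) subrr -scalar_mx_block mul1mx.
  rewrite mulmx_block !(mul1mx, mulmx1, mul0mx, mulmx0) !(addr0, add0r).
  rewrite -mulmxA -!scalar_mxM dc1 mulmx1 scaleNr subrr.
  by rewrite -scalar_mx_block.
rewrite mulmxA mul_row_block mulmx0 mulmx1 add0r.
rewrite -scalar_mxM mulmxA -scalemxAr [a *m y]mx11_scalar -/b.
rewrite scale_scalar_mx -scalar_mxM -raddfD -mulrDl cd1.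
by rewrite mul_row_block !(mul1mx, mulmx1, mulmx0) addr0 addNr.
Qed.

(** Induction on the rows: normalise the first row by column operations, recurse on the lower right
    block, then clear the column below the pivot. *)
Lemma row_injective_normal m n (M : 'M[R]_(m, n)) :
  row_injective M ->
  exists P P' : 'M[R]_n, P *m P' = 1%:M /\ M *m P = pid_mx m.
Proof.
elim: m n M => [|m IHm] n M injM.
  by exists 1%:M, 1%:M; rewrite mul1mx; split=> //; rewrite !flatmx0.
case: n M injM => [|n] M injM; first by have := row_injective_leq injM.
rewrite -[m.+1]/(1 + m)%N -[n.+1]/(1 + n)%N in M injM *.
have inju : row_injective (usubmx M).
  move=> u uM; suffices: row_mx u (0 : 'rV_m) = 0.
    by rewrite -row_mx0 => /eq_row_mx[].
  by apply: injM; rewrite -[M]vsubmxK mul_row_col mul0mx addr0.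
have [P [P' [PP' uMP]]] := row_injective_rV_normal inju.
pose v := lsubmx (dsubmx M *m P); pose M' := rsubmx (dsubmx M *m P).
have MP : M *m P = block_mx 1%:M 0 v M'.
  by rewrite -[M]vsubmxK mul_col_mx uMP block_mxEv hsubmxK.
have injM' : row_injective M'.
  (* A kernel vector [u] of [M'] lifts to the kernel vector [(- u *m v, u)] of [M *m P]. *)
  move=> u uM'; suffices: row_mx (- u *m v) u = 0.
    by rewrite -row_mx0 => /eq_row_mx[].
  apply: injM; rewrite -[M]mulmx1 -PP' [M *m _]mulmxA MP mulmxA mul_row_block.
  by rewrite mulmx1 mulNmx addNr mulmx0 add0r uM' row_mx0 mul0mx.
have [Q [Q' [QQ' M'Q]]] := IHm _ _ injM'.
have le_mn := row_injective_leq injM'.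
(* Since [m <= n], [pid_mx m *m w = v], so subtracting [w] through the reduced block cancels [v]. *)
pose w : 'M[R]_(n, 1) := pid_mx m *m v.
exists (P *m (block_mx 1%:M 0 0 Q *m block_mx 1%:M 0 (- w) 1%:M)).
exists (block_mx 1%:M 0 w 1%:M *m block_mx 1%:M 0 0 Q' *m P'); split.
  rewrite -!mulmxA [block_mx _ _ (- w) _ *m _]mulmxA.
  rewrite [X in X *m (block_mx _ _ _ Q' *m _)]mulmx_block.
  rewrite !(mul1mx, mulmx1, mul0mx, mulmx0, addr0, add0r) addNr.
  rewrite -scalar_mx_block mul1mx [block_mx _ _ _ _ *m (_ *m _)]mulmxA.
  rewrite mulmx_block !(mul1mx, mulmx1, mul0mx, mulmx0, addr0, add0r) QQ'.
  by rewrite -scalar_mx_block mul1mx.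
rewrite mulmxA MP mulmxA !mulmx_block.
rewrite !(mul1mx, mulmx1, mul0mx, mulmx0, addr0, add0r) M'Q mulmxN.
rewrite mulmxA pid_mx_id // pid_mx_1 mul1mx subrr.
apply/matrixP => i j; rewrite -[i]splitK -[j]splitK.
case: (split i) => k; case: (split j) => l /=.
- by rewrite block_mxEul !mxE /= !ord1.
- by rewrite block_mxEur !mxE /= !ord1.
- by rewrite block_mxEdl !mxE /= !ord1.
- by rewrite block_mxEdr !mxE /= !add1n eqSS ltnS.
Qed.

Lemma row_injective_rinv m n (M : 'M[R]_(m, n)) :
  row_injective M -> exists N, M *m N = 1%:M.
Proof.
move=> injM; have [P [P' [_ MP]]] := row_injective_normal injM.
exists (P *m pid_mx m).
by rewrite mulmxA MP pid_mx_id ?pid_mx_1 // (row_injective_leq injM).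
Qed.

(** The normal form says that [M] consists of the first [m] rows of the invertible [P']; its other
    rows complete them. *)
Lemma row_injective_complete m k (M : 'M[R]_(m, m + k)) :
  row_injective M -> exists M' : 'M_(k, m + k), row_injective (col_mx M M').
Proof.
move=> injM; have [P [P' [PP' MP]]] := row_injective_normal injM.
exists (row_mx 0 1%:M *m P').
suffices -> : col_mx M (row_mx 0 1%:M *m P') = P'.
  exact: rinv_row_injective (mulmx1C PP').
rewrite -{1}[M]mulmx1 -PP' mulmxA MP pid_mx_row -mul_col_mx.
by rewrite -block_mxEv -scalar_mx_block mul1mx.
Qed.

(** Normalising [K^T] gives an invertible [P^T] with [P^T *m K] equal to an identity block above
    zero; the last [k] rows of [P^T] are independent relations. *)
Lemma left_kernel_free p q k (K : 'M[R]_(p, q)) L :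
  p = (q + k)%N -> L *m K = 1%:M ->
  exists T : 'M_(k, p), T *m K = 0 /\ row_injective T.
Proof.
move=> def_p; subst p => LK1.
have /row_injective_normal[P [P' [PP' KP]]] : row_injective K^T.
  by apply: (@rinv_row_injective _ _ _ L^T); rewrite -trmx_mul LK1 trmx1.
exists (row_mx 0 1%:M *m P^T); split.
  rewrite -mulmxA -[K]trmxK -trmx_mul KP tr_pid_mx pid_mx_col mul_row_col.
  by rewrite mul0mx mulmx0 addr0.
apply: (@rinv_row_injective _ _ _ (P'^T *m col_mx 0 1%:M)).
rewrite mulmxA -[_ *m P'^T]mulmxA -trmx_mul (mulmx1C PP') trmx1 mulmx1.
by rewrite mul_row_col mul0mx mulmx1 add0r.
Qed.

End InjectiveRows.

(** * Row spans, unimodular sets and dimension *)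

Section RowSpans.

Variables (R : finComNzRingType) (n : nat).
Implicit Types A B V S : {set 'rV[R]_n}.

Definition row_span m (M : 'M[R]_(m, n)) : {set 'rV[R]_n} :=
  [set u *m M | u : 'rV_m].

Lemma mem_row_span m (M : 'M[R]_(m, n)) u : u *m M \in row_span M.
Proof. exact: imset_f. Qed.

Lemma row_in_span m (M : 'M[R]_(m, n)) i : row i M \in row_span M.
Proof. by rewrite rowE mem_row_span. Qed.

Lemma row_span_linear m (M : 'M[R]_(m, n)) : linear_subset (row_span M).
Proof.
split; first by rewrite -(mul0mx _ M) mem_row_span.
move=> a _ _ /imsetP[u _ ->] /imsetP[v _ ->].
by rewrite scalemxAl -mulmxDl mem_row_span.
Qed.

Lemma row_span_sub m (M : 'M[R]_(m, n)) V :
  linear_subset V -> (forall i, row i M \in V) -> row_span M \subset V.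
Proof.
case=> V0 Vlin rowV; apply/subsetP => _ /imsetP[u _ ->].
rewrite mulmx_sum_row; elim/big_ind: _ => // [x y xV yV|i _].
  by rewrite -[x]scale1r Vlin.
by rewrite -[_ *: _]addr0 Vlin.
Qed.

Lemma row_span_subP p m (M1 : 'M[R]_(p, n)) (M2 : 'M[R]_(m, n)) :
  row_span M1 \subset row_span M2 -> exists L, M1 = L *m M2.
Proof.
move/subsetP=> sub12.
have /fin_all_exists[L defL] i : exists u : 'rV_m, row i M1 = u *m M2.
  by have /sub12/imsetP[u _ ->] := row_in_span M1 i; exists u.
exists (\matrix_i L i); apply/row_matrixP => i.
by rewrite row_mul rowK.
Qed.

Lemma card_row_span m (M : 'M[R]_(m, n)) :
  row_injective M -> #|row_span M| = (#|R| ^ m)%N.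
Proof.
by move/row_injectiveP=> injM; rewrite card_imset // card_mx mul1n.
Qed.

Lemma sum_set_row_span a b (MA : 'M[R]_(a, n)) (MB : 'M[R]_(b, n)) :
  sum_set (row_span MA) (row_span MB) = row_span (col_mx MA MB).
Proof.
apply/setP => v; apply/imset2P/imsetP.
  case=> _ _ /imsetP[u _ ->] /imsetP[w _ ->] ->.
  by exists (row_mx u w); rewrite ?mul_row_col.
case=> u _ ->; rewrite -[u]hsubmxK mul_row_col.
by exists (lsubmx u *m MA) (rsubmx u *m MB); rewrite ?mem_row_span.
Qed.

Lemma card_sum_set A B :
  linear_subset A -> linear_subset B ->
  (#|sum_set A B| * #|A :&: B| = #|A| * #|B|)%N.
Proof.
move=> linA linB.
have gA V : linear_subset V -> group_set V.
  case=> V0 Vlin; apply/group_setP; split=> // x y xV yV.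
  by rewrite -[x]scale1r; apply: Vlin.
(* The product formula for finite groups, read in the additive group of row vectors. *)
exact/esym/(mul_cardG (Group (gA _ linA)) (Group (gA _ linB))).
Qed.

Lemma unimodularP S : reflect (exists N, rows_mx S *m N = 1%:M) (unimodular S).
Proof. exact: (iffP 'exists_eqP). Qed.

Lemma row_span_rows_mx S V : generates S V -> V = row_span (rows_mx S).
Proof.
move=> genS; apply/setP => v; apply/idP/imsetP.
  case/genS=> c ->; exists (\row_i c (enum_val i)) => //.
  rewrite mulmx_sum_row big_enum_val; apply: eq_bigr => i _.
  by rewrite mxE rowK.
case=> u _ ->; apply/genS.
exists (fun s => \sum_(i | enum_val i == s) u 0 i).
rewrite mulmx_sum_row [RHS]big_enum_val; apply: eq_bigr => i _.
rewrite rowK (big_pred1 i) // => j /=.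
by rewrite (inj_eq enum_val_inj).
Qed.

Section RowSet.

Variables (m : nat) (M : 'M[R]_(m, n)) (N : 'M[R]_(n, m)).
Hypothesis MN1 : M *m N = 1%:M.

Let S : {set 'rV[R]_n} := [set row i M | i : 'I_m].

Lemma row_inj : injective (fun i => row i M).
Proof.
move=> i j eq_ij; have : row i (M *m N) = row j (M *m N).
  by rewrite !row_mul eq_ij.
rewrite MN1 => /rowP/(_ i); rewrite !mxE eqxx.
by case: eqP => // _ /eqP; rewrite oner_eq0.
Qed.

Lemma card_row_set : #|S| = m.
Proof. by rewrite card_imset ?card_ord //; apply: row_inj. Qed.

Lemma sum_row_set (c : 'rV[R]_n -> R) :
  \sum_(s in S) c s *: s = \row_i c (row i M) *m M.
Proof.
rewrite big_imset /=; last by move=> i j _ _; apply: row_inj.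
by rewrite mulmx_sum_row; apply: eq_bigr => i _; rewrite mxE.
Qed.

(** The enumeration of [S] lists the rows of [M] in some order [f]; the columns of [N] are reordered
    by the same [f]. *)
Lemma unimodular_row_set : unimodular S.
Proof.
have /fin_all_exists[f defS] i : exists j, @enum_val _ (mem S) i = row j M.
  by have /imsetP[j _ ->] := enum_valP i; exists j.
have f_inj : injective f.
  by move=> i j eq_ij; apply: enum_val_inj; rewrite !defS eq_ij.
apply/unimodularP; exists (colsub f N).
have -> : rows_mx S = rowsub f M.
  by apply/row_matrixP => i; rewrite rowK defS row_rowsub.
rewrite -mxsub_mul MN1; apply/matrixP => i j.
by rewrite !mxE (inj_eq f_inj).
Qed.

Lemma m_subspace_row_span : m_subspace m (row_span M).
Proof.
split; first exact: row_span_linear.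
exists S; split; [exact: card_row_set | split | exact: unimodular_row_set].
  move=> c; rewrite sum_row_set => /(rinv_row_injective MN1) c0.
  move=> _ /imsetP[i _ ->].
  by move/rowP: c0 => /(_ i); rewrite !mxE.
move=> v; split=> [/imsetP[u _ ->]|[c ->]]; last first.
  by rewrite sum_row_set mem_row_span.
(* On row [i] of [M] this takes the value [u 0 i], because [M *m N] is the identity. *)
exists (fun s => (s *m N *m u^T) 0 0); rewrite sum_row_set; congr (_ *m _).
apply/rowP => i; rewrite mxE -row_mul MN1 -row_mul mul1mx.
by rewrite !mxE.
Qed.

Lemma lsdim_ge V : row_span M \subset V -> (m <= lsdim V)%N.
Proof.
move=> sMV; rewrite -{1}card_row_set.
apply: (@leq_bigmax_cond _ _ (fun S : {set 'rV[R]_n} => #|S|)).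
rewrite unimodular_row_set andbT; apply/subsetP => _ /imsetP[i _ ->].
by apply: (subsetP sMV); apply: row_in_span.
Qed.

End RowSet.

Lemma row_injective_lsdim m (M : 'M[R]_(m, n)) V :
  row_injective M -> row_span M \subset V -> (m <= lsdim V)%N.
Proof. by move/row_injective_rinv=> [N MN1]; apply: lsdim_ge MN1 _. Qed.

Lemma lsdim_witness V :
  linear_subset V ->
  exists M : 'M[R]_(lsdim V, n), exists2 N, M *m N = 1%:M & row_span M \subset V.
Proof.
move=> linV.
have [|S] := @eq_bigmax_cond {set 'rV[R]_n}
  [pred S : {set 'rV[R]_n} | (S \subset V) && unimodular S] (fun S => #|S|).
  (* The maximum is attained because the empty set is an admissible candidate. *)
  apply/card_gt0P; exists set0; rewrite inE sub0set; apply/unimodularP.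
  by exists 0; apply/matrixP => i; have := ltn_ord i; rewrite {2}cards0.
rewrite inE => /andP[sSV /unimodularP[N SN1]]; rewrite /lsdim => ->.
exists (rows_mx S), N => //; apply: row_span_sub => // i.
by rewrite rowK (subsetP sSV) // enum_valP.
Qed.

Lemma m_subspaceP m V :
  m_subspace m V ->
  exists M : 'M[R]_(m, n), exists2 N, M *m N = 1%:M & V = row_span M.
Proof.
case=> _ [S [<- [_ genS] /unimodularP[N SN1]]].
by exists (rows_mx S), N => //; apply: row_span_rows_mx.
Qed.

Lemma lsdim_row_span m (M : 'M[R]_(m, n)) :
  row_injective M -> lsdim (row_span M) = m.
Proof.
move=> injM; apply/eqP; rewrite eqn_leq (row_injective_lsdim injM) ?andbT //.
have [W [N WN1]] := lsdim_witness (row_span_linear M).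
move/subset_leq_card; rewrite !card_row_span ?leq_card_exp //.
exact: rinv_row_injective WN1.
Qed.

Lemma lsdim_leq V : linear_subset V -> (lsdim V <= n)%N.
Proof.
by case/lsdim_witness=> M [N /rinv_row_injective/row_injective_leq].
Qed.

Lemma row_span_setI_linear a b (MA : 'M[R]_(a, n)) (MB : 'M[R]_(b, n)) :
  linear_subset (row_span MA :&: row_span MB).
Proof.
have [A0 linA] := row_span_linear MA; have [B0 linB] := row_span_linear MB.
split; first by rewrite inE A0.
by move=> c u v /setIP[uA uB] /setIP[vA vB]; rewrite inE linA ?linB.
Qed.

(** * Sum and intersection of two subspaces *)

Section TwoSubspaces.

Variables (a b : nat) (MA : 'M[R]_(a, n)) (MB : 'M[R]_(b, n)).
Hypotheses (injA : row_injective MA) (injB : row_injective MB).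

Let A := row_span MA.
Let B := row_span MB.

Let linI : linear_subset (A :&: B) := row_span_setI_linear MA MB.

Let linD : linear_subset (sum_set A B).
Proof. by rewrite sum_set_row_span; apply: row_span_linear. Qed.

Let cardDI : (#|sum_set A B| * #|A :&: B| = #|R| ^ (a + b))%N.
Proof.
rewrite card_sum_set; try exact: row_span_linear.
by rewrite !card_row_span // expnD.
Qed.

Lemma lsdim_sum_cap : (lsdim (sum_set A B) + lsdim (A :&: B) <= a + b)%N.
Proof.
have [W [W' /rinv_row_injective injW sW]] := lsdim_witness linD.
have [C [C' /rinv_row_injective injC sC]] := lsdim_witness linI.
rewrite -(leq_card_exp R) -cardDI expnD -(card_row_span injW) -(card_row_span injC).
by rewrite leq_mul // subset_leq_card.
Qed.

Lemma lsdim_eq_subspace :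
  (lsdim (sum_set A B) + lsdim (A :&: B) = a + b)%N ->
  subspace (sum_set A B) /\ subspace (A :&: B).
Proof.
move=> eqab.
have [W [W' WW' sW]] := lsdim_witness linD.
have [C [C' CC' sC]] := lsdim_witness linI.
have := cardDI; rewrite -eqab expnD.
rewrite -(card_row_span (rinv_row_injective WW')).
rewrite -(card_row_span (rinv_row_injective CC')) => eq_card.
have leW := subset_leq_card sW; have leC := subset_leq_card sC.
(* Both factors of [eq_card] are bounded termwise; positivity allows cancelling one to force
   equality in the other. *)
have gt0W : (0 < #|row_span W|)%N.
  by apply/card_gt0P; exists (0 *m W); apply: mem_row_span.
have gt0C : (0 < #|row_span C|)%N.
  by apply/card_gt0P; exists (0 *m C); apply: mem_row_span.
have gt0I := leq_trans gt0C leC.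
split.
  suffices <- : row_span W = sum_set A B.
    by exists (lsdim (sum_set A B)); apply: m_subspace_row_span WW'.
  apply/eqP; rewrite eqEcard sW -(leq_pmul2r gt0I) eq_card.
  by rewrite leq_mul.
suffices <- : row_span C = A :&: B.
  by exists (lsdim (A :&: B)); apply: m_subspace_row_span CC'.
apply/eqP; rewrite eqEcard sC -(leq_pmul2l gt0W) -eq_card.
by rewrite leq_mul.
Qed.

Lemma sum_subspace_lsdim :
  subspace (sum_set A B) -> (a + b <= lsdim (sum_set A B) + lsdim (A :&: B))%N.
Proof.
case=> d /m_subspaceP[W [W' WW' defD]].
rewrite defD lsdim_row_span; last exact: rinv_row_injective WW'.
have defW : row_span (col_mx MA MB) = row_span W by rewrite -sum_set_row_span.
have [L defL] : exists L, W = L *m col_mx MA MB.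
  by apply: row_span_subP; rewrite defW.
have [K defK] : exists K, col_mx MA MB = K *m W.
  by apply: row_span_subP; rewrite defW.
have LK1 : L *m K = 1%:M.
  by rewrite -[L *m K]mulmx1 -WW' mulmxA -[L *m K *m W]mulmxA -defK -defL.
have [le_ab|/ltnW le_d] := leqP (a + b) d; first by rewrite (leq_trans le_ab) ?leq_addr.
(* The rows of [T] are [a + b - d] independent relations between the two bases; their [MA] halves
   are the opposites of their [MB] halves, hence lie in [A :&: B]. *)
have [T [TK0 injT]] := left_kernel_free (esym (subnKC le_d)) LK1.
have TM0 : lsubmx T *m MA + rsubmx T *m MB = 0.
  by rewrite -mul_row_col hsubmxK defK mulmxA TK0 mul0mx.
have defTA : lsubmx T *m MA = - rsubmx T *m MB.
  by apply/eqP; rewrite mulNmx -addr_eq0 TM0.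
rewrite -leq_subLR; apply: (@row_injective_lsdim _ (lsubmx T *m MA)).
  move=> z zT; have zA : z *m lsubmx T = 0 by apply: injA; rewrite -mulmxA.
  have zB : z *m rsubmx T = 0.
    by apply: injB; apply: oppr_inj; rewrite -mulmxA -mulmxN -mulNmx -defTA zT oppr0.
  by apply: injT; rewrite -[T]hsubmxK mul_mx_row zA zB row_mx0.
apply/subsetP => _ /imsetP[z _ ->]; rewrite inE; apply/andP; split.
  by rewrite mulmxA mem_row_span.
by rewrite defTA mulmxA mem_row_span.
Qed.

Lemma cap_subspace_lsdim :
  subspace (A :&: B) -> (a + b <= lsdim (sum_set A B) + lsdim (A :&: B))%N.
Proof.
case=> c /m_subspaceP[C [C' CC' defI]].
have injC := rinv_row_injective CC'.
have /andP[sCA sCB] : (row_span C \subset A) && (row_span C \subset B).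
  by rewrite -subsetI -defI.
have [U defU] := row_span_subP sCA; have [V defV] := row_span_subP sCB.
have injU : row_injective U.
  by move=> u uU; apply: injC; rewrite defU mulmxA uU mul0mx.
have injV : row_injective V.
  by move=> u uV; apply: injC; rewrite defV mulmxA uV mul0mx.
rewrite defI lsdim_row_span //.
have le_ca := row_injective_leq injU; have le_cb := row_injective_leq injV.
have [k def_a] : exists k, a = (c + k)%N by exists (a - c)%N; rewrite subnKC.
have [l def_b] : exists l, b = (c + l)%N by exists (b - c)%N; rewrite subnKC.
have [U' injUU'] : exists U' : 'M_(k, a), row_injective (col_mx U U').
  clear -def_a injU; subst a; exact: row_injective_complete.
have [V' injVV'] : exists V' : 'M_(l, b), row_injective (col_mx V V').
  clear -def_b injV; subst b; exact: row_injective_complete.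
suffices: (c + (k + l) <= lsdim (sum_set A B))%N.
  by move=> le_D; rewrite def_a def_b addnCA -addnA [leqRHS]addnC leq_add2l.
apply: (@row_injective_lsdim _ (col_mx C (col_mx (U' *m MA) (V' *m MB)))).
  move=> u; rewrite -[u]hsubmxK -[rsubmx u]hsubmxK.
  move: (lsubmx u) (lsubmx (rsubmx u)) (rsubmx (rsubmx u)) => {u} x y z.
  rewrite !mul_row_col addrA => /eqP; rewrite addr_eq0 => /eqP xyz.
  have xyA : x *m C + y *m (U' *m MA) = (x *m U + y *m U') *m MA.
    by rewrite mulmxDl defU !mulmxA.
  (* In a relation, the [A] part is the opposite of a vector of [B], so it is some [w *m C].
     Independence of the completed basis of [A] gives [x = w] and [y = 0]; that of [B] then gives
     [w = 0] and [z = 0]. *)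
  have : x *m C + y *m (U' *m MA) \in A :&: B.
    by rewrite inE {1}xyA mem_row_span xyz mulmxA -mulNmx mem_row_span.
  rewrite defI => /imsetP[w _ xyw].
  have /injUU' : row_mx (x - w) y *m col_mx U U' = 0.
    apply: injA; rewrite mul_row_col mulmxBl addrAC mulmxBl -xyA xyw defU mulmxA.
    by rewrite subrr.
  rewrite -row_mx0 => /eq_row_mx[/eqP]; rewrite subr_eq0 => /eqP -> ->.
  have /injVV' : row_mx w z *m col_mx V V' = 0.
    apply: injB; rewrite mul_row_col mulmxDl -!mulmxA -defV -xyw xyz.
    by rewrite addNr.
  by rewrite -row_mx0 => /eq_row_mx[-> ->]; rewrite !row_mx0.
rewrite sum_set_row_span; apply/subsetP => _ /imsetP[u _ ->].
rewrite -[u]hsubmxK -[rsubmx u]hsubmxK !mul_row_col defU !mulmxA addrA -mulmxDl.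
by rewrite -!mul_row_col mem_row_span.
Qed.

End TwoSubspaces.

End RowSpans.

Theorem theorem4p4 (R : finComNzRingType) (n : nat) (A B : {set 'rV[R]_n})
    (hA : subspace A) (hB : subspace B) :
  [/\ (maxn (lsdim A) (lsdim B) <= lsdim (sum_set A B))%N,
      (lsdim (sum_set A B)
         <= minn n (lsdim A + lsdim B - lsdim (A :&: B)))%N,
      (lsdim (sum_set A B) = lsdim A + lsdim B - lsdim (A :&: B))%N
        <-> subspace (sum_set A B)
    & subspace (sum_set A B) <-> subspace (A :&: B)].
Proof.
have [a /m_subspaceP[MA [NA /rinv_row_injective injA defA]]] := hA.
have [b /m_subspaceP[MB [NB /rinv_row_injective injB defB]]] := hB.
have subA : A \subset sum_set A B.
  apply/subsetP => x xA; rewrite -[x]addr0; apply: imset2_f => //.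
  by rewrite defB -(mul0mx _ MB) mem_row_span.
have subB : B \subset sum_set A B.
  apply/subsetP => x xB; rewrite -[x]add0r; apply: imset2_f => //.
  by rewrite defA -(mul0mx _ MA) mem_row_span.
have linD : linear_subset (sum_set A B).
  by rewrite defA defB sum_set_row_span; apply: row_span_linear.
have dimA : lsdim A = a by rewrite defA lsdim_row_span.
have dimB : lsdim B = b by rewrite defB lsdim_row_span.
have le_sum := lsdim_sum_cap injA injB.
have eq_sub := lsdim_eq_subspace injA injB.
have sum_ge := sum_subspace_lsdim injA injB.
have cap_ge := cap_subspace_lsdim injA injB.
rewrite -defA -defB in le_sum eq_sub sum_ge cap_ge.
have sum_eq : subspace (sum_set A B) ->
    (lsdim (sum_set A B) + lsdim (A :&: B) = a + b)%N.
  by move=> /sum_ge ge_sum; apply/eqP; rewrite eqn_leq le_sum.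
have cap_eq : subspace (A :&: B) ->
    (lsdim (sum_set A B) + lsdim (A :&: B) = a + b)%N.
  by move=> /cap_ge ge_sum; apply/eqP; rewrite eqn_leq le_sum.
(* This makes the truncated subtraction exact when [subnK] is applied below. *)
have le_cap : (lsdim (A :&: B) <= a + b)%N := leq_trans (leq_addl _ _) le_sum.
split.
- by rewrite geq_max !lsdimS.
- by rewrite leq_min lsdim_leq //= dimA dimB -(leq_add2r (lsdim (A :&: B))) subnK.
- rewrite dimA dimB; split=> [eqD|/sum_eq <-]; last by rewrite addnK.
  by apply: (proj1 (eq_sub _)); rewrite eqD subnK.
- by split=> [/sum_eq/eq_sub[]|/cap_eq/eq_sub[]].
Qed.
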